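(* Let $(E,\mathcal{P})$ be an abstract network with capacities $c\in\mathbb{R}_+^E$, transit times $\tau\in\mathbb{Z}_+^E$ and time horizon $T\in\mathbb{Z}_+$, and let $r(P):=T-\sum_{e\in P}\tau(e)$ for $P\in\mathcal{P}$. Let $\tilde x^*$ be an optimal solution of the static maximum weighted abstract flow problem with capacities $c$ and weights $r$, and let $x^*$ be the corresponding temporally repeated abstract flow. Let $\tilde y$ be an integral optimal solution of the dual of that static problem, and define $$\alpha(e):=\min_{P\in\mathcal{P}:\,e\in P}\ \sum_{p\in(P,e)}(\tau(p)+\tilde y(p)),\qquad C:=\{(e,\theta)\in E_T:\ \alpha(e)\le\theta<\alpha(e)+\tilde y(e)\}.$$ Then $x^*$ is a maximum abstract flow over time, and $C$ is a minimum abstract cut over time whose capacity $\sum_{(e,\theta)\in C}c(e)$ is equal to the flow value $\sum_{P_t\in\mathcal{P}_T}x^*(P_t)$.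
   Context: Abstract network: a finite ground set $E$ and a family $\mathcal{P}\subseteq 2^E$ of nonempty sets called paths, each $P\in\mathcal{P}$ equipped with a linear order $<_P$ on its elements, satisfying the switching property: for all $P,Q\in\mathcal{P}$ and $e\in P\cap Q$ there is a path $P\times_e Q\in\mathcal{P}$ with $P\times_e Q\subseteq\{p\in P: p\le_P e\}\cup\{q\in Q: q\ge_Q e\}$ (no relation between the order of $P\times_eQ$ and those of $P,Q$ is required). Notation: for $P\in\mathcal{P}$, $e\in P$, $(P,e):=\{p\in P: p<_P e\}$. If $e$ lies in no path, set $\alpha(e):=0$ by convention. Time expansion: $\mathcal{T}:=\{0,\dots,T-1\}$ and $E_T:=E\times\mathcal{T}$. For $P\in\mathcal{P}$, $t\in\mathcal{T}$ the temporal path $P_t$ is identified with $\{(e,\theta)\in E_T: e\in P,\ \theta=t+\sum_{p\in(P,e)}\tau(p)\}$, and $\mathcal{P}_T:=\{P_t: P\in\mathcal{P},\ t\in\mathcal{T},\ t+\sum_{p\in P}\tau(p)<T\}$. An abstract flow over time is a map $x:\mathcal{P}_T\to\mathbb{R}_+$; it is feasible if $\sum_{P_t\in\mathcal{P}_T:(e,\theta)\in P_t}x(P_t)\le c(e)$ for all $e\in E$, $\theta\in\mathcal{T}$. A maximum one is a feasible one maximizing $\sum_{P_t\in\mathcal{P}_T}x(P_t)$. An abstract cut over time is a set $C\subseteq E_T$ with $P_t\cap C\ne\emptyset$ for every $P_t\in\mathcal{P}_T$; a minimum one minimizes the capacity $\sum_{(e,\theta)\in C}c(e)$. Static maximum weighted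 abstract flow problem with weights $r$: maximize $\sum_{P\in\mathcal{P}}r(P)\tilde x(P)$ subject to $\sum_{P\in\mathcal{P}:e\in P}\tilde x(P)\le c(e)$ for all $e\in E$ and $\tilde x\ge0$. Its dual: minimize $\sum_{e\in E}c(e)\tilde y(e)$ subject to $\sum_{e\in P}\tilde y(e)\ge r(P)$ for all $P\in\mathcal{P}$ and $\tilde y\ge0$. The temporally repeated abstract flow of a static flow $\tilde x$ is $x(P_t):=\tilde x(P)$ for all $P\in\mathcal{P}$ and $0\le t<T-\sum_{e\in P}\tau(e)$ (i.e. for all $P_t\in\mathcal{P}_T$). *)

(* Defs.v *)
From HB Require Import structures.
From mathcomp Require Import all_boot all_order all_algebra.
From mathcomp Require Import reals.

Set Implicit Arguments.
Unset Strict Implicit.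
Unset Printing Implicit Defensive.

Import Order.TTheory GRing.Theory Num.Theory.
Local Open Scope ring_scope.

(** [path_le P] is the linear order of the path [P]; its values outside [P],
    or for a set [P] that is not a path, are irrelevant.  Reflexivity on [P]
    follows from totality. *)
Record abstract_network (E : finType) := AbstractNetwork {
  paths : {set {set E}};
  path_le : {set E} -> rel E;
  paths_neq0 : forall P, P \in paths -> P != set0;
  path_le_anti : forall P, P \in paths -> {in P &, antisymmetric (path_le P)};
  path_le_trans : forall P, P \in paths -> {in P & &, transitive (path_le P)};
  path_le_total : forall P, P \in paths -> {in P &, total (path_le P)};
  switching : forall P Q e, P \in paths -> Q \in paths -> e \in P :&: Q ->
    exists2 S : {set E}, S \in paths &
      S \subset [set p in P | path_le P p e] :|: [set q in Q | path_le Q e q]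
}.

Section Network.
Variables (R : realType) (E : finType) (N : abstract_network E).

Definition before (P : {set E}) (e : E) : {set E} :=
  [set p in P | (p != e) && path_le N P p e].

Section Static.
Variables (c : E -> R) (r : {set E} -> R).

(** Only the values on [paths N] of a flow [x : {set E} -> R] matter. *)
Definition static_feasible (x : {set E} -> R) : Prop :=
  (forall P, P \in paths N -> 0 <= x P) /\
  (forall e, \sum_(P in paths N | e \in P) x P <= c e).

Definition static_value (x : {set E} -> R) : R :=
  \sum_(P in paths N) r P * x P.

Definition static_optimal (x : {set E} -> R) : Prop :=
  static_feasible x /\
  (forall z, static_feasible z -> static_value z <= static_value x).

Definition dual_feasible (y : E -> R) : Prop :=
  (forall e, 0 <= y e) /\
  (forall P, P \in paths N -> r P <= \sum_(e in P) y e).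

Definition dual_value (y : E -> R) : R := \sum_(e : E) c e * y e.

Definition dual_optimal (y : E -> R) : Prop :=
  dual_feasible y /\ (forall z, dual_feasible z -> dual_value y <= dual_value z).

End Static.

Section Time.
Variables (c : E -> R) (tau : E -> nat) (T : nat).

(** [r(P)], which may be negative, hence the subtraction in [R]. *)
Definition path_weight (P : {set E}) : R :=
  T%:R - \sum_(e in P) (tau e)%:R.

(** The set of times [{0, ..., T-1}] is ['I_T], so [E_T] is [E * 'I_T]. *)
Definition temporal_path (P : {set E}) (t : nat) : {set E * 'I_T} :=
  [set u : E * 'I_T | (u.1 \in P)
     && (nat_of_ord u.2 == t + \sum_(p in before P u.1) tau p)%N].

Definition temporal_paths : {set {set E * 'I_T}} :=
  [set temporal_path P t | P : {set E} in paths N, t : 'I_T in 'I_T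
     & (t + \sum_(p in P) tau p < T)%N].

(** Only the values on [temporal_paths] of a flow over time matter. *)
Definition flow_feasible (x : {set E * 'I_T} -> R) : Prop :=
  (forall S, S \in temporal_paths -> 0 <= x S) /\
  (forall (e : E) (theta : 'I_T),
     \sum_(S in temporal_paths | (e, theta) \in S) x S <= c e).

Definition flow_value (x : {set E * 'I_T} -> R) : R :=
  \sum_(S in temporal_paths) x S.

Definition maximum_flow (x : {set E * 'I_T} -> R) : Prop :=
  flow_feasible x /\ (forall z, flow_feasible z -> flow_value z <= flow_value x).

Definition cut (C : {set E * 'I_T}) : Prop :=
  forall S, S \in temporal_paths -> S :&: C != set0.

Definition cut_capacity (C : {set E * 'I_T}) : R := \sum_(u in C) c u.1.

Definition minimum_cut (C : {set E * 'I_T}) : Prop :=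
  cut C /\ (forall D, cut D -> cut_capacity C <= cut_capacity D).

(** This determines [x] on [temporal_paths].  There is always such an [x]:
    [temporal_path P t] determines [P] as its projection to [E] when
    [t + \sum_(p in P) tau p < T]. *)
Definition temporally_repeated (xs : {set E} -> R)
    (x : {set E * 'I_T} -> R) : Prop :=
  forall P (t : nat), P \in paths N -> (t + \sum_(p in P) tau p < T)%N ->
    x (temporal_path P t) = xs P.

Definition prefix_cost (y : E -> R) (e : E) (P : {set E}) : R :=
  \sum_(p in before P e) ((tau p)%:R + y p).

(** The iterated minimum has no neutral element in [R]: it is started from the
    cost of some path through [e], which does not change its value. *)
Definition alpha (y : E -> R) (e : E) : R :=
  if [pick P in paths N | e \in P] is Some P0 then
    \big[Num.min/prefix_cost y e P0]_(P in paths N | e \in P) prefix_cost y e P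
  else 0.

Definition cut_of_dual (y : E -> R) : {set E * 'I_T} :=
  [set u : E * 'I_T |
     alpha y u.1 <= (nat_of_ord u.2)%:R < alpha y u.1 + y u.1].

End Time.
End Network.

(* Main.v *)
(** Weak duality over time bounds every flow by every cut, so it suffices that
    the value of [x] is at least the capacity of [C].  Static linear programming
    duality gives the chain
      capacity C <= dual value of y = static value of xs <= value of x,
    where the middle equality comes from Farkas' lemma applied to the
    constraints that are tight at [y].

    That [C] is a cut: let [P_t] avoid [C], reaching [e] at time [th e].  The
    first element of [P] has [th e >= alpha e], hence [th e >= alpha e + y e].
    Take the last [e] of [P] with the latter property and switch at [e] from a
    path [Q] attaining [alpha e] to [P], obtaining [S].  If [S] meets [P] behind
    [e], the first such element [f] of [S] has [alpha f <= th f], so that [f]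
    would also be late; otherwise [S] costs less than [T], against dual
    feasibility. *)
Require Import Defs.
From HB Require Import structures.
From mathcomp Require Import all_boot all_order all_algebra.
From mathcomp Require Import reals boolp.
From mathcomp Require Import ring lra.

Set Implicit Arguments.
Unset Strict Implicit.
Unset Printing Implicit Defensive.

Import Order.TTheory GRing.Theory Num.Theory.
Local Open Scope ring_scope.

(** * Farkas' lemma and duality for the static problem *)

Section Farkas.
Variables (R : realFieldType) (E I : finType).
Implicit Types (u v w b d : E -> R) (a : I -> E -> R).

Definition dot u v : R := \sum_e u e * v e.

Lemma dotBr u v w k : dot u (fun e => v e - k * w e) = dot u v - k * dot u w.
Proof.
by rewrite /dot mulr_sumr -sumrB; apply: eq_bigr => e _; ring.
Qed.

Lemma dotBl u v w k : dot (fun e => v e - k * w e) u = dot v u - k * dot w u.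
Proof.
by rewrite /dot mulr_sumr -sumrB; apply: eq_bigr => e _; ring.
Qed.

(** Induction on the list of constraints. If those in [s] alone already force [dot b d] to be
    nonnegative, [j] gets multiplier 0. Otherwise some [d0] satisfies [s] with [dot b d0 < 0]; it
    must violate [j], and [a j] is eliminated along [d0]. *)
Lemma farkas a b (s : seq I) : uniq s ->
    (forall d, (forall i, i \in s -> 0 <= dot (a i) d) -> 0 <= dot b d) ->
  exists l : I -> R, (forall i, 0 <= l i) /\
    (forall e, b e = \sum_(i <- s) l i * a i e).
Proof.
elim: s a b => [|j s IHs] a b /=.
  move=> _ b_ge0; exists (fun=> 0); split=> // e; rewrite big_nil.
  have b_e k : dot b (fun e' => if e' == e then k else 0) = b e * k.
    rewrite /dot (bigD1 e) //= eqxx big1 ?addr0 // => e' /negbTE ->.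
    exact: mulr0.
  have := b_ge0 (fun e' => if e' == e then 1 else 0) (fun i => ltac:(by [])).
  have := b_ge0 (fun e' => if e' == e then -1 else 0) (fun i => ltac:(by [])).
  by rewrite !b_e => *; apply/eqP; rewrite eq_le; apply/andP; split; lra.
move=> /andP[jNs s_uniq] b_ge0.
have neqj i : i \in s -> (i == j) = false.
  by move=> si; apply: contraNF jNs => /eqP <-.
have [b_ge0'|] := pselect (forall d,
    (forall i, i \in s -> 0 <= dot (a i) d) -> 0 <= dot b d).
  have [l [l_ge0 lE]] := IHs a b s_uniq b_ge0'.
  exists (fun i => if i == j then 0 else l i); split=> [i|e]; first by case: ifP.
  rewrite big_cons eqxx mul0r add0r lE [LHS]big_seq [RHS]big_seq.
  by apply: eq_bigr => i /neqj ->.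
move=> /existsNP[d0 /not_implyP[ad0 /negP]]; rewrite -ltNge => bd0.
have ajd0 : dot (a j) d0 < 0.
  rewrite ltNge; apply/negP => ajd0.
  suff : 0 <= dot b d0 by rewrite leNgt bd0.
  by apply: b_ge0 => i; rewrite inE => /orP[/eqP ->|/ad0].
set k := dot (a j) d0 in ajd0.
have k_neq0 : k != 0 by rewrite lt_eqF.
(* Project along [d0] onto the hyperplane where [a j] vanishes. *)
pose a' i e := a i e - dot (a i) d0 / k * a j e.
pose b' e := b e - dot b d0 / k * a j e.
have [d ad|l [l_ge0 lE]] := IHs a' b' s_uniq.
  have proj u : dot (fun e => u e - dot u d0 / k * a j e) d =
                dot u (fun e => d e - dot (a j) d / k * d0 e).
    by rewrite dotBl dotBr; ring.
  rewrite proj; apply: b_ge0 => i; rewrite inE => /orP[/eqP ->|si].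
    by rewrite dotBr -/k divfK // subrr.
  by rewrite -proj; apply: ad.
(* Collects the multiples of [a j] that the projection removed from [b] and the [a i]. It is
   nonnegative since [k < 0], [dot b d0 < 0] and [d0] satisfies all of [s]. *)
pose lj := dot b d0 / k - \sum_(i <- s) l i * (dot (a i) d0 / k).
have kV_le0 : k^-1 <= 0 by rewrite invr_le0 ltW.
exists (fun i => if i == j then lj else l i); split=> [i|e].
  case: ifP => // _; rewrite subr_ge0 (@le_trans _ _ 0) //.
    rewrite big_seq sumr_le0 // => i' /ad0 ad0i'.
    by rewrite mulr_ge0_le0 // mulr_ge0_le0.
  by rewrite mulr_le0 // ltW.
have be : b e = b' e + dot b d0 / k * a j e by rewrite /b' subrK.
rewrite big_cons eqxx be lE.
have -> : \sum_(i <- s) (if i == j then lj else l i) * a i e =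
    \sum_(i <- s) l i * a' i e +
    (\sum_(i <- s) l i * (dot (a i) d0 / k)) * a j e.
  rewrite mulr_suml -big_split big_seq [RHS]big_seq /=.
  by apply: eq_bigr => i /neqj ->; rewrite /a'; ring.
by rewrite /lj; ring.
Qed.

End Farkas.

(** Constraints with positive slack tolerate a short step in any direction, so only tight ones
    restrict [d]. Each negative [d j] caps the step at [s j / - d j]. *)
Lemma small_step (R : realFieldType) (I : finType) (s d : I -> R) :
    (forall i, 0 <= s i) -> (forall i, s i = 0 -> 0 <= d i) ->
  exists2 eps, 0 < eps & forall i, 0 <= s i + eps * d i.
Proof.
move=> s_ge0 d_ge0.
suff [eps eps_gt0 epsP] : exists2 eps, 0 < eps &
    forall i, i \in enum I -> 0 <= s i + eps * d i.
  by exists eps => // i; apply: epsP; rewrite mem_enum.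
elim: (enum I) => [|j r [eps eps_gt0 epsP]]; first by exists 1.
have step i e e' : 0 < e' <= e -> 0 <= s i + e * d i -> 0 <= s i + e' * d i.
  move=> /andP[e'_gt0 e'e] se; have := s_ge0 i.
  have [di|di] := leP 0 (d i); first by move=> si; rewrite addr_ge0 // mulr_ge0 // ltW.
  by move=> _; apply: le_trans se _; rewrite lerD2l ler_nM2r.
have [dj|dj] := leP 0 (d j).
  exists eps => // i; rewrite inE => /orP[/eqP ->|/epsP //].
  by rewrite addr_ge0 // mulr_ge0 // ltW.
have sj : 0 < s j.
  by rewrite lt_neqAle s_ge0 andbT eq_sym; apply: contraTneq dj => /d_ge0; rewrite leNgt.
pose e' := s j / - d j.
have e'_gt0 : 0 < e' by rewrite divr_gt0 // oppr_gt0.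
exists (Num.min eps e'); first by rewrite lt_min eps_gt0.
move=> i; rewrite inE => /orP[/eqP ->|/epsP]; last first.
  by apply: step; rewrite lt_min eps_gt0 e'_gt0 ge_min lexx.
apply: (step _ e'); first by rewrite lt_min eps_gt0 e'_gt0 ge_min lexx orbT.
by rewrite /e' invrN mulrN mulNr divfK ?lt_eqF // subrr.
Qed.

Lemma dual_optimal_primal (R : realType) (E : finType) (N : abstract_network E)
    (c : E -> R) (r : {set E} -> R) (y : E -> R) :
    dual_optimal N c r y ->
  exists2 z, static_feasible N c z & static_value N r z = dual_value c y.
Proof.
move=> [[y_ge0 yP] y_opt].
pose a (i : {set E} + E) e : R :=
  match i with inl P => (e \in P)%:R | inr e' => (e == e')%:R end.
pose valid (i : {set E} + E) := if i is inl P then P \in paths N else true.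
pose slack (i : {set E} + E) :=
  match i with inl P => \sum_(e in P) y e - r P | inr e => y e end.
have dot_inl P d : dot (a (inl P)) d = \sum_(e in P) d e.
  rewrite /dot [RHS]big_mkcond; apply: eq_bigr => e _ /=.
  by case: (e \in P); rewrite ?mul1r ?mul0r.
have dot_inr e d : dot (a (inr e)) d = d e.
  rewrite /dot (bigD1 e) //= eqxx mul1r big1 ?addr0 // => e' /negbTE ->.
  exact: mul0r.
pose A := [set i | valid i && (slack i == 0)].
have [d ad_ge0|l [l_ge0 lE]] := @farkas _ _ _ a c _ (enum_uniq A).
  (* Moving [y] slightly in the direction [d] preserves dual feasibility. *)
  pose s i := if valid i then slack i else 0.
  pose h i := if valid i then dot (a i) d else 0.
  have [i|i|eps eps_gt0 epsP] := @small_step _ _ s h.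
  - rewrite /s; case: ifP => // valid_i; case: i valid_i => //= P NP.
    by rewrite subr_ge0 yP.
  - rewrite /s /h; case: ifP => // valid_i slack0; apply: ad_ge0.
    by rewrite mem_enum inE valid_i slack0 eqxx.
  have yd : dual_feasible N r (fun e => y e + eps * d e).
    split=> [e|P NP]; first by have := epsP (inr e); rewrite /s /h /= dot_inr.
    have := epsP (inl P); rewrite /s /h /= NP dot_inl mulr_sumr.
    by rewrite big_split /= => ?; lra.
  have := y_opt _ yd; rewrite /dual_value.
  under [leRHS]eq_bigr do rewrite mulrDr mulrCA.
  by rewrite big_split /= lerDl -mulr_sumr pmulr_rge0.
pose z P := if inl P \in A then l (inl P) else 0.
pose w e := if inr e \in A then l (inr e) else 0.
have z_ge0 P : 0 <= z P by rewrite /z; case: ifP.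
have w_ge0 e : 0 <= w e by rewrite /w; case: ifP.
have cE e : c e = \sum_(P in paths N | e \in P) z P + w e.
  rewrite lE big_enum big_mkcond big_sumType /=; congr (_ + _).
    rewrite [RHS]big_mkcond; apply: eq_bigr => P _; rewrite /z inE /=.
    by case: (P \in _); case: (e \in P); rewrite /= ?mulr1 ?mulr0 ?if_same.
  rewrite (bigD1 e) //= eqxx mulr1 big1 ?addr0 // => e' /negbTE.
  by rewrite eq_sym => ->; rewrite mulr0 if_same.
exists z; first by split=> // e; rewrite cE lerDl.
rewrite /dual_value /static_value.
(* Complementary slackness: [z P] vanishes unless [P] is tight, and [w e * y e = 0]. *)
transitivity (\sum_(P in paths N) \sum_(e in P) z P * y e).
  apply: eq_bigr => P NP; rewrite -mulr_sumr /z inE /= NP /=.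
  by case: eqP => [/subr0_eq ->|_]; rewrite ?mul0r ?mulr0 // mulrC.
rewrite (exchange_big_dep predT) //=; apply: eq_bigr => e _.
rewrite cE mulrDl -mulr_suml [w e * _](_ : _ = 0) ?addr0 //.
by rewrite /w inE /=; case: eqP => [->|]; rewrite ?mulr0 ?mul0r.
Qed.

(** * Path orders, temporal paths and weak duality over time *)

Section Flow.
Variables (R : realType) (E : finType) (N : abstract_network E).
Variables (c : E -> R) (tau : E -> nat) (T : nat).

(** Makes [#|before N P e|] a rank on [P], by which first and last elements are chosen. *)
Lemma before_proper P e f : P \in paths N -> e \in P -> f \in P ->
  e \in before N P f -> before N P e \proper before N P f.
Proof.
move=> NP Pe Pf; rewrite inE Pe /= => /andP[ef e_le_f].
apply/properP; split; last by exists e; rewrite !inE ?eqxx ?andbF // Pe ef.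
apply/subsetP => p; rewrite !inE => /andP[Pp /andP[pe p_le_e]].
rewrite Pp (path_le_trans NP Pe Pp Pf p_le_e e_le_f) andbT /=.
apply: contra_neq ef => pf; subst p.
by apply: (path_le_anti NP Pe Pf); rewrite e_le_f.
Qed.

Lemma path_min P (A : {set E}) : P \in paths N -> A \subset P -> A != set0 ->
  exists2 e, e \in A & [disjoint before N P e & A].
Proof.
move=> NP /subsetP AP /set0Pn[e0 Ae0].
case: (arg_minnP (fun e => #|before N P e|) Ae0) => e Ae e_min; exists e => //.
apply/pred0P => f /=; apply/negP => /andP[fe Af].
have := proper_card (before_proper NP (AP _ Af) (AP _ Ae) fe).
by rewrite ltnNge e_min.
Qed.

Lemma path_max P (A : {set E}) : P \in paths N -> A \subset P -> A != set0 ->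
  exists2 e, e \in A & forall f, f \in A -> e \notin before N P f.
Proof.
move=> NP /subsetP AP /set0Pn[e0 Ae0].
case: (arg_maxnP (fun e => #|before N P e|) Ae0) => e Ae e_max; exists e => //.
move=> f Af; apply/negP => ef.
have := proper_card (before_proper NP (AP _ Ae) (AP _ Af) ef).
by rewrite ltnNge; move/negP; apply; apply: e_max.
Qed.

(** Index set for sums over [temporal_paths], on which [path_from] is injective. *)
Let departures : {set {set E} * 'I_T} :=
  [set u : {set E} * 'I_T |
     (u.1 \in paths N) && (u.2 + \sum_(p in u.1) tau p < T)%N].

Lemma before_sum_le P e :
  (\sum_(p in before N P e) tau p <= \sum_(p in P) tau p)%N.
Proof.
rewrite [leqLHS]big_mkcond [leqRHS]big_mkcond leq_sum //= => p _.
by rewrite inE; case: (p \in P) => //=; case: ifP.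
Qed.

Lemma mem_temporal_path (P : {set E}) t e : (t + \sum_(p in P) tau p < T)%N -> e \in P ->
  exists2 theta : 'I_T, (e, theta) \in temporal_path N tau T P t &
    theta = (t + \sum_(p in before N P e) tau p)%N :> nat.
Proof.
move=> tP Pe.
have tT : (t + \sum_(p in before N P e) tau p < T)%N.
  by apply: leq_ltn_trans tP; rewrite leq_add2l before_sum_le.
by exists (Ordinal tT) => //; rewrite inE /= Pe eqxx.
Qed.

Lemma temporal_path_inj (P Q : {set E}) t s : P != set0 ->
    (t + \sum_(p in P) tau p < T)%N -> (s + \sum_(p in Q) tau p < T)%N ->
  temporal_path N tau T P t = temporal_path N tau T Q s -> P = Q /\ t = s.
Proof.
move=> /set0Pn[e Pe] tP sQ PQ.
have PQE : P = Q.
  apply/setP => f; apply/idP/idP => [Pf|Qf].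
    by have [th] := mem_temporal_path tP Pf; rewrite PQ inE => /andP[].
  by have [th] := mem_temporal_path sQ Qf; rewrite -PQ inE => /andP[].
split=> //; have [th] := mem_temporal_path tP Pe.
by rewrite PQ -PQE inE /= => /andP[_ /eqP ->] /addIn.
Qed.

Let path_from (u : {set E} * 'I_T) := temporal_path N tau T u.1 u.2.

Lemma temporal_pathsE :
  temporal_paths N tau T = path_from @: departures.
Proof.
apply/setP => S; apply/imset2P/imsetP => [[P t NP]|[[P t]]].
  by rewrite inE /= => tP ->; exists (P, t); rewrite // inE NP.
by rewrite inE /= => /andP[NP tP] ->; exists P t; rewrite ?inE.
Qed.

Lemma departures_inj :
  {in departures &, injective path_from}.
Proof.
move=> [P t] [Q s]; rewrite !inE /= => /andP[NP tP] /andP[NQ sQ].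
by move=> /(temporal_path_inj (paths_neq0 NP) tP sQ)[-> /ord_inj ->].
Qed.

Lemma sum_temporal_paths (F : {set E * 'I_T} -> R) (p : pred {set E * 'I_T}) :
  \sum_(S in temporal_paths N tau T | p S) F S =
  \sum_(u in departures | p (path_from u))
     F (path_from u).
Proof.
rewrite big_mkcondr [RHS]big_mkcondr temporal_pathsE.
by rewrite big_imset //; apply: departures_inj.
Qed.

(** Double counting: the capacity of [D] bounds the flow through its elements, where every temporal
    path is counted at least once. *)
Lemma cut_bound (z : {set E * 'I_T} -> R) (D : {set E * 'I_T}) : flow_feasible N c tau z -> cut N tau D ->
  flow_value N tau z <= cut_capacity c D.
Proof.
move=> [z_ge0 zc] cutD.
apply: (@le_trans _ _ (\sum_(u in D)
    \sum_(S in temporal_paths N tau T | u \in S) z S)); last first.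
  by apply: ler_sum => -[e th] _; apply: zc.
rewrite (exchange_big_dep (mem (temporal_paths N tau T))) /=; last first.
  by move=> u S _ /andP[].
apply: ler_sum => S TS; have /set0Pn[u] := cutD _ TS.
rewrite inE => /andP[Su Du]; rewrite (bigD1 u) /=; last by rewrite Du TS.
by rewrite lerDl sumr_ge0 // => *; apply: z_ge0.
Qed.

(** * Temporally repeated flows *)

Section Repeated.
Variables (xs : {set E} -> R) (x : {set E * 'I_T} -> R).
Hypotheses (xs_feas : static_feasible N c xs).
Hypothesis (x_rep : temporally_repeated N tau xs x).

(** The arrival time at [e] determines the departure time, so at most one copy of each path uses
    [(e, th)] and the load is at most the static load of [e]. *)
Lemma repeated_feasible : flow_feasible N c tau x.
Proof.
have [xs_ge0 xsc] := xs_feas; split=> [S|e th].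
  rewrite temporal_pathsE => /imsetP[[P t]]; rewrite inE /= => /andP[NP tP] ->.
  by rewrite x_rep // xs_ge0.
apply: le_trans (xsc e); rewrite sum_temporal_paths.
pose D := [set u in departures |
  (e, th) \in path_from u].
have D_inj : {in D &, injective fst}.
  move=> [P t] [Q s]; rewrite !inE /= => /andP[_ /andP[_ /eqP tE]].
  move=> /andP[_ /andP[_ /eqP sE]] PQ; rewrite -PQ in sE *; congr (_, _).
  by apply/ord_inj/(@addIn (\sum_(p in before N P e) tau p)); rewrite -tE.
have -> : \sum_(u in departures | (e, th) \in path_from u)
    x (path_from u) = \sum_(u in D) xs u.1.
  apply: eq_big => [u|[P t]]; first by rewrite [RHS]inE.
  by rewrite inE /= => /andP[/andP[NP tP] _]; rewrite x_rep.
rewrite -(big_imset xs D_inj) /= [leLHS]big_mkcond [leRHS]big_mkcond.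
apply: ler_sum => P _; case: ifP => [/imsetP[[Q t]]|_].
  by rewrite !inE /= => /andP[/andP[NQ _] /andP[Qe _]] ->; rewrite NQ Qe.
by case: ifP => // /andP[NP _]; apply: xs_ge0.
Qed.

(** The number of copies of [P] is the truncated difference of [T] and its transit time, which
    exceeds [path_weight] where the latter is negative. *)
Lemma repeated_value :
  static_value N (path_weight R tau T) xs <= flow_value N tau x.
Proof.
have [xs_ge0 _] := xs_feas.
rewrite /static_value.
have -> : flow_value N tau x = \sum_(P in paths N)
    \sum_(t < T | (t + \sum_(p in P) tau p < T)%N) xs P.
  rewrite pair_big_dep /flow_value.
  transitivity (\sum_(S in temporal_paths N tau T | predT S) x S).
    by apply: eq_bigl => S; rewrite andbT.
  rewrite sum_temporal_paths; apply: eq_big => [u|[P t]].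
    by rewrite inE andbT.
  by rewrite inE andbT => /andP[NP tP]; rewrite x_rep.
apply: ler_sum => P NP; rewrite /path_weight -natr_sum.
set s := (\sum_(p in P) tau p)%N.
under eq_bigl do rewrite addnC -ltn_subRL.
rewrite -(big_ord_widen T (fun=> xs P)) ?leq_subr // sumr_const card_ord.
rewrite -[leRHS]mulr_natl ler_wpM2r ?xs_ge0 // lerBlDr -natrD ler_nat.
by rewrite addnC -leq_subLR.
Qed.

End Repeated.

(** * The cut given by a dual solution *)

Section Cut.
Variable y : E -> R.

Lemma alpha_le P e : P \in paths N -> e \in P ->
  alpha N tau y e <= prefix_cost N tau y e P.
Proof.
move=> NP Pe; rewrite /alpha; case: pickP => [P0 _|/(_ P)]; last by rewrite NP Pe.
by apply: bigmin_le_cond; rewrite NP.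
Qed.

Lemma alpha_attained P e : P \in paths N -> e \in P ->
  exists Q, [/\ Q \in paths N, e \in Q & alpha N tau y e = prefix_cost N tau y e Q].
Proof.
move=> NP Pe; rewrite /alpha; case: pickP => [P0 /andP[NP0 P0e]|/(_ P)]; last by rewrite NP Pe.
elim/big_ind: _ => [|a b [Qa Qa_alpha] [Qb Qb_alpha]|Q /andP[NQ Qe]].
- by exists P0.
- by rewrite minEle; case: ifP => _; [exists Qa|exists Qb].
- by exists Q.
Qed.

Lemma before_sum_lt P e f : P \in paths N -> e \in P -> f \in P ->
    e \in before N P f ->
  (\sum_(p in before N P e) tau p + tau e <= \sum_(p in before N P f) tau p)%N.
Proof.
move=> NP Pe Pf ef; rewrite addnC [leqRHS](bigD1 e) //= leq_add2l.
have /properP[/subsetP sub _] := before_proper NP Pe Pf ef.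
rewrite [leqLHS]big_mkcond [leqRHS]big_mkcond leq_sum //= => p _.
case: ifP => // pe; rewrite (sub _ pe) /=.
by move: pe; rewrite !inE => /and3P[_ -> _].
Qed.

Lemma cut_of_dual_cut : dual_feasible N (path_weight R tau T) y ->
  cut N tau (cut_of_dual N tau T y).
Proof.
move=> [y_ge0 yP] S0; rewrite temporal_pathsE => /imsetP[[P t]].
rewrite inE /= => /andP[NP tP] ->; apply/negP => /eqP miss.
have cost_ge0 p : 0 <= (tau p)%:R + y p by rewrite addr_ge0.
pose th e := (t + \sum_(p in before N P e) tau p)%N.
have late e : e \in P -> alpha N tau y e <= (th e)%:R ->
    alpha N tau y e + y e <= (th e)%:R.
  move=> Pe ae; rewrite leNgt; apply/negP => eC.
  have [th' th'P th'E] := mem_temporal_path tP Pe.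
  have : (e, th') \in set0 by rewrite -miss inE th'P inE /= th'E ae.
  by rewrite inE.
pose A := [set e in P | alpha N tau y e + y e <= (th e)%:R].
have AP : A \subset P by apply/subsetP => e; rewrite inE => /andP[].
have A_neq0 : A != set0.
  (* The first element of [P] has an empty prefix, so its [alpha] is at most 0. *)
  have [e Pe /pred0P e_min] := path_min NP (subxx P) (paths_neq0 NP).
  apply/set0Pn; exists e; rewrite inE Pe late //.
  apply: le_trans (alpha_le NP Pe) _; rewrite /prefix_cost big1 // => p pe.
  by have := e_min p; rewrite /= pe; move: pe; rewrite inE => /andP[->].
have [e Ae e_max] := path_max NP AP A_neq0.
have [Pe e_late] : e \in P /\ alpha N tau y e + y e <= (th e)%:R.
  by move: Ae; rewrite inE => /andP.
(* Behind [e] nothing on [P] is late, so [alpha f] exceeds the arrival time at [f], which is no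
   earlier than the departure from [e]. *)
have early f : f \in P -> e \in before N P f ->
    (th e + tau e)%:R < alpha N tau y f.
  move=> Pf ef; apply: (@le_lt_trans _ _ (th f)%:R).
    by rewrite ler_nat -addnA leq_add2l before_sum_lt.
  rewrite ltNge; apply/negP => /(late _ Pf) f_late.
  by have := e_max f; rewrite ef inE Pf f_late => /(_ isT).
have [Q [NQ Qe alphaE]] := alpha_attained NP Pe.
have QPe : e \in Q :&: P by rewrite inE Qe.
have [S NS /subsetP SQP] := switching NQ NP QPe.
(* Both the prefix of [S] up to its first element behind [e] on [P] and, if
   there is no such element, the whole of [S] stay inside [Q] up to [e]. *)
have prefix_le (B : {set E}) : B \subset e |: before N Q e ->
    \sum_(p in B) ((tau p)%:R + y p) <= (th e + tau e)%:R.
  move=> /subsetP BQ.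
  apply: (@le_trans _ _ (\sum_(p in e |: before N Q e) ((tau p)%:R + y p))).
    rewrite [leLHS]big_mkcond [leRHS]big_mkcond ler_sum //= => p _.
    by case: ifP => [/BQ -> //|_]; case: ifP.
  (* As [Q] attains [alpha e], its cost through [e] is [alpha e + tau e + y e], bounded by lateness
     of [e]. *)
  rewrite big_setU1 ?inE ?eqxx ?andbF //= natrD.
  by move: e_late; rewrite alphaE /prefix_cost; lra.
have SQ p : p \in S -> (p \in e |: before N Q e) ||
    (p \in P) && (e \in before N P p).
  move=> /SQP; rewrite !inE => /orP[/andP[-> ->]|/andP[-> ->]].
    by rewrite andbT; case: eqP.
  by rewrite Pe andbT /= [e == p]eq_sym; case: eqP => //=; rewrite orbT.
pose B := [set p in S | (p \in P) && (e \in before N P p)].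
have BS : B \subset S by apply/subsetP => p; rewrite inE => /andP[].
have [B0|B_neq0] := eqVneq B set0.
  have : \sum_(p in S) ((tau p)%:R + y p) <= (th e + tau e)%:R.
    apply: prefix_le; apply/subsetP => p Sp.
    have /orP[//|ep] := SQ _ Sp.
    by have : p \in B; [rewrite inE Sp | rewrite B0 inE].
  rewrite big_split /= => S_le; have := yP S NS; rewrite /path_weight => S_ge.
  have : (T%:R : R) <= (th e + tau e)%:R by lra.
  rewrite ler_nat leqNgt => /negP; apply; apply: leq_ltn_trans tP.
  rewrite -addnA leq_add2l addnC [leqRHS](bigD1 e) //= leq_add2l.
  rewrite [leqLHS]big_mkcond [leqRHS]big_mkcond leq_sum //= => p _.
  by rewrite inE; case: (p \in P) => //=; case: (p == e) => //=; case: ifP.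
(* First in the order of [S] itself, which need not agree with that of [P]: whatever precedes [f] on
   [S] then lies in [Q] up to [e]. *)
have [f Bf /pred0P f_min] := path_min NS BS B_neq0.
have [Sf Pf ef] : [/\ f \in S, f \in P & e \in before N P f].
  by move: Bf; rewrite inE => /and3P.
have := early f Pf ef; rewrite ltNge => /negP; apply.
apply: le_trans (alpha_le NS Sf) _; apply: prefix_le.
apply/subsetP => p pf; have Sp : p \in S by move: pf; rewrite inE => /andP[].
have /orP[//|ep] := SQ _ Sp.
by have := f_min p; rewrite /= pf inE Sp ep.
Qed.

(** With [alpha] and [y] integral, each [e] contributes the integers of an interval of length [y e];
    times from [T] on are cut off, hence an inequality. *)
Lemma cut_of_dual_capacity : (forall e, 0 <= c e) ->
    (forall e, 0 <= y e) -> (forall e, y e \is a Num.int) ->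
  cut_capacity c (cut_of_dual N tau T y) <= dual_value c y.
Proof.
move=> c_ge0 y_ge0 y_int.
have y_nat e : y e \is a Num.nat by rewrite natrEint y_int y_ge0.
have alpha_nat e : alpha N tau y e \is a Num.nat.
  have [[P /andP[NP Pe]]|none] := pickP [pred P in paths N | e \in P].
    have [Q [_ _ ->]] := alpha_attained NP Pe.
    by apply: rpred_sum => p _; rewrite rpredD ?rpred_nat.
  rewrite /alpha; case: pickP => [P|_]; last exact: rpred0.
  by have := none P; rewrite /= => ->.
pose X e := [pred th : 'I_T | (e, th) \in cut_of_dual N tau T y].
have -> : cut_capacity c (cut_of_dual N tau T y) =
    \sum_e \sum_(th | th \in X e) c e.
  by rewrite pair_big_dep; apply: eq_bigl => -[e th].
apply: ler_sum => e _; rewrite sumr_const -[leLHS]mulr_natr ler_wpM2l //.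
have /natrP[m am] := alpha_nat e; have /natrP[k yk] := y_nat e.
rewrite yk ler_nat -(size_iota m k) cardE -(size_map val) uniq_leq_size //.
  by rewrite map_inj_uniq ?enum_uniq //; apply: val_inj.
move=> j /mapP[i]; rewrite mem_enum inE inE /= am yk -natrD ler_nat ltr_nat.
by rewrite mem_iota => ? ->.
Qed.

End Cut.
End Flow.

Theorem corollary7 (R : realType) (E : finType) (N : abstract_network E)
    (c : E -> R) (c_ge0 : forall e, 0 <= c e) (tau : E -> nat) (T : nat)
    (xs : {set E} -> R)
    (xs_opt : static_optimal N c (path_weight R tau T) xs)
    (x : {set E * 'I_T} -> R)
    (x_rep : temporally_repeated N tau xs x)
    (y : E -> R)
    (y_int : forall e, y e \is a Num.int)
    (y_opt : dual_optimal N c (path_weight R tau T) y) :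
  let C := cut_of_dual N tau T y in
  maximum_flow N c tau x /\
  minimum_cut N c tau C /\
  cut_capacity c C = flow_value N tau x.
Proof.
move=> C.
have y_feas : dual_feasible N (path_weight R tau T) y by case: y_opt.
have [y_ge0 _] := y_feas; have [xs_feas xs_max] := xs_opt.
have x_feas := repeated_feasible xs_feas x_rep.
have C_cut : cut N tau C := cut_of_dual_cut y_feas.
have C_le_x : cut_capacity c C <= flow_value N tau x.
  apply: le_trans (cut_of_dual_capacity N tau T c_ge0 y_ge0 y_int) _.
  have [z z_feas <-] := dual_optimal_primal y_opt.
  exact: le_trans (xs_max _ z_feas) (repeated_value xs_feas x_rep).
split; first by split=> // z z_feas; apply: le_trans (cut_bound z_feas _) C_le_x.
split; first by split=> // D D_cut; apply: le_trans C_le_x (cut_bound _ _).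
by apply/eqP; rewrite eq_le C_le_x cut_bound.
Qed.
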